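(* Let $X$ be an approximate subring definable in a structure $M$. Then $X$ is commensurable with an approximate subring $Y\subseteq\langle X\rangle$, definable in $M$, which is closed under multiplication, i.e. $Y\cdot Y\subseteq Y$. In fact, such a $Y$ can be found which is additionally contained in $4X+X\cdot 4X$.
   Context: Rings are associative but not necessarily commutative or unital. For subsets $Y,Z$ of a ring, $Y+Z=\{y+z\}$, $Y\cdot Z=\{yz\}$ ($y\in Y,z\in Z$), and $nZ$ is the set of sums of $n$ elements of $Z$. A subset $X$ of a ring is an approximate subring if it is additively symmetric ($0\in X$, $X=-X$) and $(X\cdot X)\cup(X+X)$ is covered by finitely many additive translates of $X$. $\langle X\rangle$ is the subring generated by $X$. Recursively, $X_0=X$, $X_{n+1}=X_n+X_n+X_n\cdot X_n$. An approximate subring $X$ is definable in a (first-order) structure $M$ if all the sets $X_0,X_1,\dots$ are definable in $M$ (with parameters) and the restrictions of $+$ and $\cdot$ to each $X_n$ are definable in $M$. Two subsets are commensurable if each is covered by finitely many additive translates of the other. *)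

(* Defs.v *)
From HB Require Import structures.
From mathcomp Require Import all_boot all_order all_algebra.
From mathcomp Require Import boolp classical_sets cardinality.

Set Implicit Arguments.
Unset Strict Implicit.
Unset Printing Implicit Defensive.

Import GRing.Theory.
Local Open Scope classical_set_scope.
Local Open Scope ring_scope.

(* A unit is not required, unlike in MathComp's [pzRingType] and its descendants. *)
HB.mixin Record Zmodule_isRng R of GRing.Zmodule R := {
  rng_mul : R -> R -> R;
  rng_mulA : associative rng_mul;
  rng_mulDl : left_distributive rng_mul +%R;
  rng_mulDr : right_distributive rng_mul +%R
}.

#[short(type="rngType")]
HB.structure Definition Rng := {R of GRing.Zmodule R & Zmodule_isRng R}.

Section ApproximateSubrings.
Variable R : rngType.
Implicit Types X Y Z : set R.

Definition sumset Y Z : set R := [set y + z | y in Y & z in Z].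
Definition prodset Y Z : set R := [set rng_mul y z | y in Y & z in Z].

(* The sums of [n] elements of [Z], not the multiples [z *+ n]. *)
Definition nsumset n Z : set R :=
  [set \sum_(i < n) z i | z in [set z : 'I_n -> R | forall i, Z (z i)]].

Definition is_subring (S : set R) : Prop :=
  [/\ S 0, forall x y, S x -> S y -> S (x - y)
    & forall x y, S x -> S y -> S (rng_mul x y)].

Definition subring_gen X : set R := smallest is_subring X.

Definition covered_by_translates Y Z : Prop :=
  exists2 T : set R, finite_set T & Y `<=` sumset T Z.

Definition commensurable Y Z : Prop :=
  covered_by_translates Y Z /\ covered_by_translates Z Y.

Definition approximate_subring X : Prop :=
  [/\ X 0, X = [set - x | x in X]
    & covered_by_translates (prodset X X `|` sumset X X) X].

Fixpoint stage X n : set R :=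
  if n is m.+1 then
    sumset (sumset (stage X m) (stage X m)) (prodset (stage X m) (stage X m))
  else X.

End ApproximateSubrings.

Record language := Language {
  fun_symbol : Type;
  rel_symbol : Type;
  fun_arity : fun_symbol -> nat;
  rel_arity : rel_symbol -> nat
}.

Record structure (L : language) := Structure {
  universe :> Type;
  fun_interp : forall f : fun_symbol L, (fun_arity f).-tuple universe -> universe;
  rel_interp : forall r : rel_symbol L, (rel_arity r).-tuple universe -> Prop
}.

Inductive term (L : language) :=
| Var of nat
| App (f : fun_symbol L) of ('I_(fun_arity f) -> term L).

(* De Bruijn variables: [All] binds the variable 0 of its body. *)
Inductive formula (L : language) :=
| Bot
| Equal of term L & term L
| Rel (r : rel_symbol L) of ('I_(rel_arity r) -> term L)
| Imp of formula L & formula L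
| All of formula L.

Section Definability.
Variables (L : language) (M : structure L).

Fixpoint eval (v : nat -> M) (t : term L) : M :=
  match t with
  | Var i => v i
  | App f ts => fun_interp [tuple eval v (ts i) | i < fun_arity f]
  end.

Definition extend (a : M) (v : nat -> M) (i : nat) : M :=
  if i is j.+1 then v j else a.

Fixpoint sat (v : nat -> M) (phi : formula L) : Prop :=
  match phi with
  | Bot => False
  | Equal s t => eval v s = eval v t
  | Rel r ts => rel_interp [tuple eval v (ts i) | i < rel_arity r]
  | Imp phi psi => sat v phi -> sat v psi
  | All phi => forall a, sat (extend a v) phi
  end.

(* The free variables [0, ..., n - 1] are read off the tuple; the free variables
   [n], [n + 1], ... are the parameters [c 0], [c 1], ..., of which a formula
   uses only finitely many. *)
Definition definable n (D : set (n.-tuple M)) : Prop :=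
  exists (phi : formula L) (c : nat -> M),
    D = [set a | sat (fun i => nth (c (i - n)%N) a i) phi].

Variables (R : rngType) (k : nat) (e : R -> k.-tuple M).

Definition op_graph (op : R -> R -> R) (Z : set R) :
    set ((k + (k + k)).-tuple M) :=
  [set [tuple of e x ++ (e y ++ e (op x y))] | x in Z & y in Z].

(* The map [e] identifies the elements of the subring generated by [X] with
   elements of [M ^ k]; its values outside this subring are irrelevant. *)
Definition definable_via (X : set R) : Prop :=
  {in subring_gen X &, injective e} /\
  forall n, [/\ definable (e @` stage X n),
                definable (op_graph +%R (stage X n))
              & definable (op_graph (@rng_mul R) (stage X n))].

End Definability.

(* Main.v *)
(* Let K = 4X + X(4X). For any set K, the set Y of those y in K with yK <= K is
   closed under multiplication, and here it is definable by a first-order formula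
   over the stages of X; so the point is that finitely many translates of Y cover
   X. By pigeonhole, for a finite subset F of the subring generated by X,
   finitely many translates of {s in 2X | sF <= 2X}, or of {z in 2X | Fz <= 2X},
   cover X. Applied twice, this yields a set S of elements s of 2X with sK <= K
   that has the same property, and S <= Y. *)
Require Import Defs.
From mathcomp Require Import all_boot all_order all_algebra.
From mathcomp Require Import boolp classical_sets cardinality.

Set Implicit Arguments.
Unset Strict Implicit.
Unset Printing Implicit Defensive.

Import GRing.Theory.
Local Open Scope classical_set_scope.
Local Open Scope ring_scope.

(** * Rings without unit: generated subrings, sums of [n] elements, and stages *)

Section RngTheory.
Variable R : rngType.
Implicit Types (x y : R) (X Y Z : set R).

Lemma rng_mul0l x : rng_mul 0 x = 0.
Proof. by apply: (@addrI _ (rng_mul 0 x)); rewrite -rng_mulDl !addr0. Qed.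

Lemma rng_mul0r x : rng_mul x 0 = 0.
Proof. by apply: (@addrI _ (rng_mul x 0)); rewrite -rng_mulDr !addr0. Qed.

Lemma rng_mulNl x y : rng_mul (- x) y = - rng_mul x y.
Proof. by apply/eqP; rewrite -addr_eq0 -rng_mulDl addNr rng_mul0l. Qed.

Lemma rng_mulNr x y : rng_mul x (- y) = - rng_mul x y.
Proof. by apply/eqP; rewrite -addr_eq0 -rng_mulDr addNr rng_mul0r. Qed.

Lemma is_subring_gen X : is_subring (subring_gen X).
Proof.
split=> [S [[]]//|x y xG yG S|x y xG yG S] SX; have [[_ SB SM] _] := SX.
- by apply: SB; [apply: xG|apply: yG].
- by apply: SM; [apply: xG|apply: yG].
Qed.

Lemma sub_subring_gen X : X `<=` subring_gen X.
Proof. by move=> x Xx S [_]; apply. Qed.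

Lemma subring_gen_min X Y : is_subring Y -> X `<=` Y -> subring_gen X `<=` Y.
Proof. by move=> Yring XY x; apply. Qed.

Lemma subring_genD X x y :
  subring_gen X x -> subring_gen X y -> subring_gen X (x + y).
Proof.
have [G0 GB _] := is_subring_gen X => Gx Gy.
by rewrite -(opprK y); apply: (GB) => //; rewrite -sub0r; apply: GB.
Qed.

Lemma sumsetS X X' Y Y' : X `<=` X' -> Y `<=` Y' -> sumset X Y `<=` sumset X' Y'.
Proof. by move=> sX sY _ [x Xx [y Yy <-]]; exists x; [apply: sX|exists y => //; apply: sY]. Qed.

Lemma prodsetS X X' Y Y' :
  X `<=` X' -> Y `<=` Y' -> prodset X Y `<=` prodset X' Y'.
Proof. by move=> sX sY _ [x Xx [y Yy <-]]; exists x; [apply: sX|exists y => //; apply: sY]. Qed.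

Lemma nsumset1 X : nsumset 1 X = X.
Proof.
apply/seteqP; split=> [_ [z zX <-]|x Xx]; first by rewrite big_ord1; apply: zX.
by exists (fun=> x) => //; rewrite big_ord1.
Qed.

Lemma nsumsetS n X : nsumset n.+1 X = sumset (nsumset n X) X.
Proof.
apply/seteqP; split=> [_ [z zX <-]|_ [_ [z zX <-] [x Xx <-]]].
  rewrite big_ord_recr; exists (\sum_(i < n) z (widen_ord (leqnSn n) i)).
    by exists (fun i => z (widen_ord (leqnSn n) i)) => // i; apply: zX.
  by exists (z ord_max); [apply: zX|].
(* The family [z] is extended by [x] at the last index [n], the only one at which [insub] fails. *)
exists (fun i : 'I_n.+1 => if insub (val i) is Some j then z j else x).
  by move=> i; case: insubP => // j _ _; apply: zX.
rewrite big_ord_recr /= insubF ?ltnn//; congr (_ + _).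
by apply: eq_bigr => i _ /=; rewrite insubT//= => ni; congr z; apply: val_inj.
Qed.

Lemma nsumsetD m n X : sumset (nsumset m.+1 X) (nsumset n.+1 X) = nsumset (m + n).+2 X.
Proof.
elim: n => [|n IHn]; first by rewrite nsumset1 addn0 -nsumsetS.
rewrite (nsumsetS n.+1) addnS [RHS]nsumsetS -IHn.
apply/seteqP; split=> [_ [x Xx [_ [y Yy [z Zz <-]] <-]]|].
  by exists (x + y); [exists x => //; exists y|exists z; rewrite ?addrA].
by move=> _ [_ [x Xx [y Yy <-]] [z Zz <-]]; exists x => //;
  exists (y + z); [exists y => //; exists z|rewrite addrA].
Qed.

Lemma nsumset_leq m n X : X 0 -> (0 < m)%N -> (m <= n)%N ->
  nsumset m X `<=` nsumset n X.
Proof.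
move=> X0; case: m => // m _ /subnKC <-; elim: (n - m.+1)%N => [|d IHd].
  by rewrite addn0.
rewrite addnS [X in _ `<=` X]nsumsetS => x /IHd nx; exists x => //; exists 0 => //.
exact: addr0.
Qed.

Lemma nsumsetN n X : (forall x, X x -> X (- x)) ->
  forall x, nsumset n X x -> nsumset n X (- x).
Proof.
move=> XN _ [z zX <-]; exists (fun i => - z i); last by rewrite sumrN.
by move=> i; apply: XN.
Qed.

Lemma stage0 n X : X 0 -> stage X n 0.
Proof.
move=> X0; elim: n => //= n IHn; exists 0; last exists 0; rewrite ?addr0//.
  by exists 0 => //; exists 0; rewrite ?addr0.
by exists 0 => //; exists 0; rewrite ?rng_mul0l.
Qed.

Lemma sumset_sub_stage n X Y Z : X 0 -> Y `<=` stage X n -> Z `<=` stage X n ->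
  sumset Y Z `<=` stage X n.+1.
Proof.
move=> /(stage0 n) X0 YX ZX y /(sumsetS YX ZX) yX; exists y => //.
by exists 0; rewrite ?addr0//; exists 0 => //; exists 0; rewrite ?rng_mul0l.
Qed.

Lemma prodset_sub_stage n X Y Z : X 0 -> Y `<=` stage X n -> Z `<=` stage X n ->
  prodset Y Z `<=` stage X n.+1.
Proof.
move=> /(stage0 n) X0 YX ZX y /(prodsetS YX ZX) yX; exists 0.
  by exists 0 => //; exists 0; rewrite ?addr0.
by exists y; rewrite ?add0r.
Qed.

Lemma stage_leq m n X : X 0 -> (m <= n)%N -> stage X m `<=` stage X n.
Proof.
move=> X0 /subnKC <-; elim: (n - m)%N => [|d IHd]; first by rewrite addn0.
rewrite addnS => x /IHd stx.
apply: (sumset_sub_stage X0 (@subset_refl _ _) (@subset_refl _ _)).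
by exists x => //; exists 0; rewrite ?addr0//; apply: stage0.
Qed.

Lemma stageS X Y n : X `<=` Y -> stage X n `<=` stage Y n.
Proof.
move=> XY; elim: n => //= n IHn.
by apply: sumsetS; [apply: sumsetS|apply: prodsetS].
Qed.

(** Together with [stageS], this places the stages of any subset of [stage X m] inside later stages
    of [X]. *)
Lemma stage_add m n X : stage (stage X m) n = stage X (n + m).
Proof. by elim: n => //= n ->. Qed.

Lemma stage_sub_gen X n : stage X n `<=` subring_gen X.
Proof.
have [_ _ GM] := is_subring_gen X.
elim: n => [|n IHn]; first exact: sub_subring_gen.
move=> _ [_ [x /IHn Gx [y /IHn Gy <-]] [_ [u /IHn Gu [v /IHn Gv <-]] <-]].
by apply: subring_genD; [apply: subring_genD|apply: GM].
Qed.

End RngTheory.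

(** * Covering by finitely many translates, and the pigeonhole argument *)

Section Covering.
Variable R : rngType.
Implicit Types (x y : R) (X Y Z F : set R).
Local Notation cov := (@covered_by_translates R).

Lemma cov_sub X Y Z : X `<=` Y -> cov Y Z -> cov X Z.
Proof. by move=> XY [T finT YT]; exists T => //; apply: subset_trans YT. Qed.

Lemma sub_cov X Y : X `<=` Y -> cov X Y.
Proof.
move=> XY; exists [set 0]; first exact: finite_set1.
by move=> x Xx; exists 0 => //; exists x; rewrite ?add0r//; apply: XY.
Qed.

Lemma cov_trans Y X Z : cov X Y -> cov Y Z -> cov X Z.
Proof.
move=> [T finT XT] [U finU YU]; exists (sumset T U).
  exact: finite_image2.
move=> x /XT[t Tt [y /YU[u Uu [z Zz <-]] <-]].
by exists (t + u); [exists t => //; exists u|exists z; rewrite ?addrA].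
Qed.

Lemma cov_sumset X X' Y Y' : cov X X' -> cov Y Y' ->
  cov (sumset X Y) (sumset X' Y').
Proof.
move=> [T finT XT] [U finU YU]; exists (sumset T U); first exact: finite_image2.
move=> _ [_ /XT[t Tt [x Xx <-]] [_ /YU[u Uu [y Yy <-]] <-]].
exists (t + u); first by exists t => //; exists u.
by exists (x + y); [exists x => //; exists y|rewrite addrACA].
Qed.

Lemma cov_bigcup X (F : set R) (A : R -> set R) : finite_set F ->
  (forall f, F f -> cov (A f) X) -> cov (\bigcup_(f in F) A f) X.
Proof.
move=> finF AX.
have /choice[T HT] f : exists T : set R,
    finite_set T /\ (F f -> A f `<=` sumset T X).
  have [/AX[T finT AT]|nF] := pselect (F f); first by exists T.
  by exists set0; split.
exists (\bigcup_(f in F) T f).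
  by apply: bigcup_finite => // f _; case: (HT f).
move=> x [f Ff Afx]; have [_ /(_ Ff) /(_ x Afx)[t Tt [y Xy <-]]] := HT f.
by exists t; [exists f|exists y].
Qed.

(** A translate [t] that is really used has the form [x - y] with [x] in [X] and [y] in [Y], so it
    lies in the subring and all others can be discarded. The translates can then serve as
    multipliers in [approx_cov_mul]. *)
Lemma cov_in_gen W X Y : X `<=` subring_gen W -> Y `<=` subring_gen W ->
  cov X Y -> exists T : set R,
    [/\ finite_set T, T `<=` subring_gen W & X `<=` sumset T Y].
Proof.
move=> XG YG [T finT XT]; exists (T `&` subring_gen W); split.
- exact: finite_setIl.
- exact: subIsetr.
move=> x Xx; have [t Tt [y Yy eqx]] := XT x Xx; exists t; last by exists y.
split=> //; have [_ GB _] := is_subring_gen W.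
by rewrite -(addrK y t) eqx; apply: GB; [apply: XG|apply: YG].
Qed.

(* Pigeonhole: subtracting a representative of its colour class puts every
   element of [X] into the set of monochromatic differences. *)
Lemma cov_monochromatic_diff (C : Type) (g : R -> C) X : finite_set (g @` X) ->
  cov X [set z | exists x y, [/\ X x, X y, g x = g y & z = x - y]].
Proof.
move=> fin_gX.
have /choice[r rP] c : exists y, (g @` X) c -> X y /\ g y = c.
  by have [[y Xy <-]|nc] := pselect ((g @` X) c); [exists y|exists 0].
exists (r @` (g @` X)); first exact: finite_image.
move=> x Xx; have gx : (g @` X) (g x) by exists x.
have [Xr gr] := rP _ gx.
exists (r (g x)); first by exists (g x).
by exists (x - r (g x)); [exists x, (r (g x))|rewrite addrC subrK].
Qed.

(** Colour [x] by the family of translates [t f x], for [f] in [F], such that [h f x] lies in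
    [t f x + X]. If [x] and [y] have the same colour, the translates cancel in [h f x - h f y],
    which is thus a difference of two elements of [X]. Keeping [h] abstract covers both left and
    right multiplication. *)
Lemma cov_common_preimage X F (h : R -> R -> R) :
    (forall x, X x -> X (- x)) -> finite_set F ->
    (forall f x y, F f -> h f (x - y) = h f x - h f y) ->
    (forall f, F f -> cov (h f @` X) X) ->
  cov X [set x | sumset X X x /\ forall f, F f -> sumset X X (h f x)].
Proof.
move=> XN /finite_seqP[s ->] hB hX.
have /choice[t tP] f : exists t : R -> R, f \in s ->
    finite_set (t @` X) /\ forall x, X x -> X (h f x - t x).
  have [fs|_] := boolP (f \in s); last by exists id.
  have [T finT hT] := hX f fs.
  have /choice[t tP] x : exists t, X x -> T t /\ X (h f x - t).
    have [Xx|] := pselect (X x); last by exists 0.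
    have [|t Tt [y Xy <-]] := hT (h f x); first by exists x.
    by exists t; rewrite addrC addKr.
  exists t => _; split=> [|x /tP[]//].
  by apply: sub_finite_set finT => _ [x /tP[]? _ <-].
pose g x := [seq t f x | f <- s].
(* There are finitely many colours, by induction on [s]: a colour is a value of [t f] followed by a
   colour for the remaining list. *)
have fin_g : finite_set (g @` X).
  rewrite /g; elim: s tP {hB hX g} => [|f s IHs] tP.
    by apply: (@sub_finite_set _ _ [set [::]]) => [_ [? _ <-]//|]; apply: finite_set1.
  have [|fin_t _] := tP f; first exact: mem_head.
  have {}IHs := IHs (fun f' f's => tP f' (mem_behead (s := f :: s) f's)).
  apply: sub_finite_set (finite_image2 cons fin_t IHs).
  by move=> _ [x Xx <-]; exists (t f x); [exists x|exists [seq t f' x | f' <- s] => //; exists x].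
apply: cov_trans (cov_monochromatic_diff fin_g) (sub_cov _).
move=> _ [x [y [Xx Xy gxy ->]]]; split=> [|f fs].
  by exists x => //; exists (- y) => //; apply: XN.
have txy : t f x = t f y by move/eq_in_map: gxy; apply.
have [_ tX] := tP f fs.
exists (h f x - t f x); first exact: tX.
exists (- (h f y - t f y)); first exact/XN/tX.
by rewrite hB // txy opprB addrA subrK.
Qed.

End Covering.

(** * The stabilizer of [K] as a multiplicatively closed approximate subring *)

Section MultiplicativelyClosed.
Variables (R : rngType) (X : set R).
Hypothesis X_approx : approximate_subring X.
Local Notation cov := (@covered_by_translates R).
Local Notation G := (subring_gen X).

Lemma approx0 : X 0. Proof. by case: X_approx. Qed.

Lemma approxN x : X x -> X (- x).
Proof. by have [_ XN _] := X_approx; rewrite {2}XN => Xx; exists x. Qed.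

Lemma approx_cov_sumset : cov (sumset X X) X.
Proof. by have [_ _] := X_approx; apply: cov_sub => x; right. Qed.

Lemma approx_cov_prodset : cov (prodset X X) X.
Proof. by have [_ _] := X_approx; apply: cov_sub => x; left. Qed.

(* The elements with both covering properties form a subring containing [X]. *)
Lemma approx_cov_mul f : G f ->
  cov (rng_mul f @` X) X /\ cov ((rng_mul^~ f) @` X) X.
Proof.
move: f; apply: subring_gen_min => [|f Xf]; last first.
  split; apply: cov_sub approx_cov_prodset => _ [x Xx <-].
    by exists f => //; exists x.
  by exists x => //; exists f.
split=> [|f g [fX Xf] [gX Xg]|f g [fX Xf] [gX Xg]].
- by split; apply: sub_cov => _ [x _ <-]; rewrite ?rng_mul0l ?rng_mul0r; apply: approx0.
- split.
    apply: cov_sub (cov_trans (cov_sumset fX gX) approx_cov_sumset).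
    move=> _ [x Xx <-]; exists (rng_mul f x); first by exists x.
    (* By the symmetry of [X], the difference [f x - g x] becomes the sum [f x + g (- x)] of
       elements of [f X] and [g X]. *)
    exists (rng_mul g (- x)); first by exists (- x) => //; apply: approxN.
    by rewrite rng_mulDl rng_mulNl rng_mulNr.
  apply: cov_sub (cov_trans (cov_sumset Xf Xg) approx_cov_sumset).
  move=> _ [x Xx <-]; exists (rng_mul x f); first by exists x.
  exists (rng_mul (- x) g); first by exists (- x) => //; apply: approxN.
  by rewrite rng_mulDr rng_mulNl rng_mulNr.
- split.
    (* From [g X <= T + X] follows [f g X <= f T + f X], and [f X] is already covered by translates
       of [X]. *)
    apply: cov_trans fX; have [T finT gT] := gX.
    exists (rng_mul f @` T); first exact: finite_image.
    move=> _ [x Xx <-]; have [|t Tt [y Xy ty]] := gT (rng_mul g x); first by exists x.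
    exists (rng_mul f t); first by exists t.
    by exists (rng_mul f y); [exists y|rewrite -rng_mulA -ty rng_mulDr].
  apply: cov_trans Xg; have [T finT fT] := Xf.
  exists ((rng_mul^~ g) @` T); first exact: finite_image.
  move=> _ [x Xx <-]; have [|t Tt [y Xy ty]] := fT (rng_mul x f); first by exists x.
  exists (rng_mul t g); first by exists t.
  by exists (rng_mul y g); [exists y|rewrite rng_mulA -ty rng_mulDl].
Qed.

Definition big_set : set R := sumset (nsumset 4 X) (prodset X (nsumset 4 X)).

Definition big_stabilizer : set R :=
  [set y | big_set y /\ forall x, big_set x -> big_set (rng_mul y x)].

Lemma nsumset2 : nsumset 2 X = sumset X X.
Proof. by rewrite nsumsetS nsumset1. Qed.

Lemma nsumset4 : nsumset 4 X = sumset (sumset X X) (sumset X X).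
Proof. by rewrite -nsumset2 (nsumsetD 1 1). Qed.

Lemma nsumset_sub_gen n : nsumset n X `<=` G.
Proof.
move=> _ [z zX <-]; elim/big_rec: _ => [|i x _ Gx].
  by case: (is_subring_gen X).
by apply: subring_genD; first by apply: sub_subring_gen; apply: zX.
Qed.

Lemma big_set_sub_gen : big_set `<=` G.
Proof.
have [_ _ GM] := is_subring_gen X.
move=> _ [x /nsumset_sub_gen Gx [_ [y /sub_subring_gen Gy [z /nsumset_sub_gen Gz <-]] <-]].
by apply: subring_genD => //; apply: GM.
Qed.

Lemma nsumset4_sub_big : nsumset 4 X `<=` big_set.
Proof.
move=> x x4; exists x => //; exists 0; last by rewrite addr0.
exists 0; first exact: approx0.
exists 0; last exact: rng_mul0l.
by exists (fun=> 0) => [i|]; [apply: approx0|rewrite big1].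
Qed.

Lemma sumset_sub_big : sumset X X `<=` big_set.
Proof.
by rewrite -nsumset2 => x /(nsumset_leq approx0 (n := 4)) x4; apply/nsumset4_sub_big/x4.
Qed.

Lemma big_setN x : big_set x -> big_set (- x).
Proof.
move=> [a a4 [_ [b Xb [c c4 <-]] <-]]; exists (- a).
  by apply: nsumsetN => //; apply: approxN.
exists (rng_mul (- b) c); last by rewrite rng_mulNl opprD.
by exists (- b); [apply: approxN|exists c].
Qed.

Lemma cov_nsumset4 : cov (nsumset 4 X) X.
Proof.
rewrite nsumset4; apply: cov_trans approx_cov_sumset.
exact: cov_sumset approx_cov_sumset approx_cov_sumset.
Qed.

(** Choose a finite [F] in the generated subring with [4X <= F + X]. Then [X (4X)] lies in the sum
    of the union of the sets [X f], for [f] in [F], and [X X]; each of these is covered by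
    translates of [X]. *)
Lemma cov_big_set : cov big_set X.
Proof.
apply: cov_trans approx_cov_sumset; apply: cov_sumset; first exact: cov_nsumset4.
have [F [finF FG XF]] :=
  cov_in_gen (@nsumset_sub_gen 4) (@sub_subring_gen _ X) cov_nsumset4.
have covF : cov (\bigcup_(f in F) ((rng_mul^~ f) @` X)) X.
  by apply: cov_bigcup => // f /FG /approx_cov_mul[].
apply: cov_trans approx_cov_sumset.
apply: cov_sub (cov_sumset covF approx_cov_prodset).
move=> _ [x Xx [_ /XF[f Ff [y Xy <-]] <-]].
exists (rng_mul x f); first by exists f => //; exists x.
by exists (rng_mul x y); [exists x => //; exists y|rewrite rng_mulDr].
Qed.

(* Write [2X <= F' + X], let [Z] be the set of [z] in [2X] with [F' z <= 2X],
   write [big_set <= F + Z], and let [S] be the set of [s] in [2X] with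
   [s F <= 2X]. For [s = f' + x] in [S] and [k = f + z] in [big_set],
   [s k = s f + f' z + x z] lies in [2X + 2X + X (2X)], hence in [big_set]. *)
Lemma cov_big_stabilizer : cov X big_stabilizer.
Proof.
have XXG : sumset X X `<=` G by rewrite -nsumset2; apply: nsumset_sub_gen.
have mulBr f x y : rng_mul f (x - y) = rng_mul f x - rng_mul f y :> R.
  by rewrite rng_mulDr rng_mulNr.
have mulBl f x y : rng_mul (x - y) f = rng_mul x f - rng_mul y f :> R.
  by rewrite rng_mulDl rng_mulNl.
have [F' [finF' F'G XXF']] :=
  cov_in_gen XXG (@sub_subring_gen _ X) approx_cov_sumset.
have covZ := cov_common_preimage (h := rng_mul) approxN finF'
  (fun f x y _ => mulBr f x y) (fun f Ff => (approx_cov_mul (F'G f Ff)).1).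
set Z := [set _ | _] in covZ.
have ZG : Z `<=` G by move=> z [/XXG].
have [F [finF FG KF]] :=
  cov_in_gen big_set_sub_gen ZG (cov_trans cov_big_set covZ).
have covS := cov_common_preimage (h := fun f x => rng_mul x f) approxN finF
  (fun f x y _ => mulBl f x y) (fun f Ff => (approx_cov_mul (FG f Ff)).2).
apply: cov_trans covS (sub_cov _) => s [XXs sF].
split=> [|_ /KF[f Ff [z [XXz F'z] <-]]]; first exact: sumset_sub_big.
have [f' F'f' [x Xx eqs]] := XXF' _ XXs.
exists (rng_mul s f + rng_mul f' z).
  rewrite nsumset4; exists (rng_mul s f); first exact: sF.
  by exists (rng_mul f' z) => //; apply: F'z.
exists (rng_mul x z); last by rewrite rng_mulDr -addrA -rng_mulDl eqs.
exists x => //; exists z => //.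
by rewrite nsumset4; exists z => //; exists 0; rewrite ?addr0//;
  exists 0; [apply: approx0|exists 0; rewrite ?addr0//; apply: approx0].
Qed.

Lemma big_stabilizer_mul : prodset big_stabilizer big_stabilizer `<=` big_stabilizer.
Proof.
move=> _ [x [Kx xK] [y [Ky yK] <-]]; split=> [|z Kz]; first exact: xK.
by rewrite -rng_mulA; apply/xK/yK.
Qed.

Lemma big_stabilizer_commensurable : commensurable X big_stabilizer.
Proof.
split; first exact: cov_big_stabilizer.
by apply: cov_sub cov_big_set => y [].
Qed.

(** Symmetry is inherited from [big_set]. Products stay in the set, at the cost of the single
    translate 0. Sums are covered by passing through [X + X] and [X], thanks to commensurability. *)
Lemma big_stabilizer_approx : approximate_subring big_stabilizer.
Proof.
have [covX covY] := big_stabilizer_commensurable.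
have YN y : big_stabilizer y -> big_stabilizer (- y).
  move=> [Ky yK]; split=> [|x Kx]; first exact: big_setN.
  by rewrite rng_mulNl; apply/big_setN/yK.
split.
- split=> [|x Kx].
    by apply: sumset_sub_big; exists 0; [apply: approx0|exists 0; rewrite ?addr0//; apply: approx0].
  rewrite rng_mul0l.
  by apply: sumset_sub_big; exists 0; [apply: approx0|exists 0; rewrite ?addr0//; apply: approx0].
- apply/seteqP; split=> [y Yy|_ [y /YN Yy <-]//].
  by exists (- y); [apply: YN|rewrite opprK].
have [T finT YYT] : cov (sumset big_stabilizer big_stabilizer) big_stabilizer.
  apply: cov_trans covX; apply: cov_trans approx_cov_sumset.
  exact: cov_sumset.
exists (0 |` T); first by rewrite finite_setU; split=> //; apply: finite_set1.
move=> y [/big_stabilizer_mul Yy|/YYT[t Tt [z Yz <-]]].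
  by exists 0; [left|exists y; rewrite ?add0r].
by exists t; [right|exists z].
Qed.

(** The ring operations are given as definable only on the stages of [X], so each piece of [big_set]
    has to be located in some stage; every sum or product raises the index by one. *)
Lemma sumset_sub_stage1 : sumset X X `<=` stage X 1.
Proof. exact: (sumset_sub_stage (n := 0)) approx0 _ _. Qed.

Lemma nsumset4_sub_stage : nsumset 4 X `<=` stage X 2.
Proof.
rewrite nsumset4.
exact: sumset_sub_stage approx0 sumset_sub_stage1 sumset_sub_stage1.
Qed.

Lemma prodset_sub_stage3 : prodset X (nsumset 4 X) `<=` stage X 3.
Proof.
apply: prodset_sub_stage approx0 _ nsumset4_sub_stage.
exact: (stage_leq approx0 (leq0n 2)).
Qed.

Lemma big_set_sub_stage : big_set `<=` stage X 4.
Proof.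
apply: sumset_sub_stage approx0 _ prodset_sub_stage3.
exact: subset_trans nsumset4_sub_stage (stage_leq approx0 _).
Qed.

End MultiplicativelyClosed.

(** * Renaming of variables and blocks of universal quantifiers *)

Section Formulas.
Variables (L : language) (M : structure L).

Fixpoint rename_term (s : nat -> nat) (t : term L) : term L :=
  match t with
  | Var i => Var L (s i)
  | App f ts => App (fun i => rename_term s (ts i))
  end.

Definition lift_renaming (s : nat -> nat) (i : nat) : nat :=
  if i is j.+1 then (s j).+1 else 0.

Fixpoint rename (s : nat -> nat) (phi : formula L) : formula L :=
  match phi with
  | Bot => Bot L
  | Equal t u => Equal (rename_term s t) (rename_term s u)
  | Rel r ts => Rel (fun i => rename_term s (ts i))
  | Imp phi psi => Imp (rename s phi) (rename s psi)
  | All phi => All (rename (lift_renaming s) phi)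
  end.

Lemma eval_rename (v : nat -> M) s t :
  eval v (rename_term s t) = eval (v \o s) t.
Proof.
elim: t => //= f ts IHt; congr (fun_interp _).
by apply: eq_mktuple => i; apply: IHt.
Qed.

Lemma sat_rename phi : forall (v : nat -> M) s,
  sat v (rename s phi) = sat (v \o s) phi.
Proof.
elim: phi => [|t u|r ts|phi IHphi psi IHpsi|phi IHphi] v s //=.
- by rewrite !eval_rename.
- congr (rel_interp _); apply: eq_mktuple => i; exact: eval_rename.
- by rewrite IHphi IHpsi.
- apply: eq_forall => a; rewrite IHphi; congr (sat _ _).
  by apply/funext => -[].
Qed.

Lemma sat_iter_All n phi : forall v : nat -> M,
  sat v (iter n (@All L) phi) <->
  forall a : nat -> M, sat (fun i => if (i < n)%N then a i else v (i - n)%N) phi.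
Proof.
elim: n => [|n IHn] v.
  split=> [satv a|/(_ v)] /=; last by under eq_fun do rewrite subn0.
  by under eq_fun do rewrite subn0.
(* The outermost quantifier of the block binds the variable [n], the last of the block. *)
have step (a : nat -> M) : (fun i => if (i < n)%N then a i else extend (a n) v (i - n)%N)
    = (fun i => if (i < n.+1)%N then a i else v (i - n.+1)%N).
  apply/funext => i; rewrite ltnS; case: ltngtP => // [lt_ni|->].
    by rewrite -(subnSK lt_ni).
  by rewrite subnn.
rewrite iterS /=; split=> [satv a|satv b].
  by rewrite -step; apply: (IHn _).1 (satv (a n)) a.
apply/IHn => a; have := satv (fun i => if i == n then b else a i).
rewrite -step eqxx; congr sat.
by apply/funext => i; case: ltngtP => // [lt_in|->]; rewrite ?eqxx ?(ltn_eqF lt_in).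
Qed.

End Formulas.

(** * Definability with variables ranging over [k]-tuples *)

Section TupleEnvironments.
Variables (L : language) (M : structure L) (k : nat) (m0 : M).
Local Notation T := (k.-tuple M).
Implicit Types (P Q : (nat -> T) -> Prop) (w : nat -> T).

(* The variable [i] of a formula stands for a coordinate of one of the tuples of
   the environment if [r i] is [inl], and for a parameter if it is [inr]. *)
Definition lookup (r : nat -> nat * 'I_k + M) w (i : nat) : M :=
  match r i with inl jl => tnth (w jl.1) jl.2 | inr m => m end.

(** Definability of a predicate on sequences of tuples. As [r] is chosen along with the formula,
    renaming tuples changes only [r], and parameters are carried along. *)
Definition defin P : Prop :=
  exists (phi : formula L) (r : nat -> nat * 'I_k + M),
    forall w, P w <-> sat (lookup r w) phi.

Lemma defin_ext Q P : (forall w, P w <-> Q w) -> defin Q -> defin P.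
Proof.
by move=> PQ [phi [r phiP]]; exists phi, r => w; rewrite PQ.
Qed.

Lemma defin_rename P (s : nat -> nat) : defin P -> defin (fun w => P (w \o s)).
Proof.
move=> [phi [r phiP]]; exists phi.
exists (fun i => match r i with inl jl => inl (s jl.1, jl.2) | inr m => inr m end).
move=> w; rewrite phiP.
suff -> : lookup r (w \o s) = lookup (fun i => match r i with
  inl jl => inl (s jl.1, jl.2) | inr m => inr m end) w by [].
by apply/funext => i; rewrite /lookup; case: (r i).
Qed.

Lemma defin_False : defin (fun=> False).
Proof. by exists (Bot L), (fun=> inr m0). Qed.

(** The variables of the two formulas are moved to even and odd positions, so that their two lookups
    merge into one without clashes. *)
Lemma defin_imp P Q : defin P -> defin Q -> defin (fun w => P w -> Q w).
Proof.
move=> [phi [r phiP]] [psi [q psiQ]].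
exists (Imp (rename double phi) (rename (fun i => i.*2.+1) psi)).
pose rq i := if odd i then q i./2 else r i./2.
exists rq => w; rewrite phiP psiQ /= !sat_rename.
have -> : lookup rq w \o double = lookup r w.
  by apply/funext => i; rewrite /lookup /rq /= odd_double doubleK.
have -> // : lookup rq w \o (fun i => i.*2.+1) = lookup q w.
by apply/funext => i; rewrite /lookup /rq /= odd_double /= uphalf_double.
Qed.

Definition push (t : T) w (i : nat) : T := if i is j.+1 then w j else t.

Lemma defin_all P : defin P -> defin (fun w => forall t, P (push t w)).
Proof.
move=> [phi [r phiP]].
(* A quantifier over tuples becomes a block of [k] quantifiers: the coordinates of tuple 0 become
   the bound variables below [k], and every other variable is shifted past them. *)
pose s i := match r i with inl (0, l) => val l | _ => (k + i)%N end.
(* The tuple [j.+1] of the pushed environment is the tuple [j] of the old one. The value at [j = 0]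
   is a dummy, since such variables are bound. *)
pose q i := match r i with inl (j, l) => inl (j.-1, l) | inr m => inr m end.
exists (iter k (@All L) (rename s phi)), q => w.
have step t (a : nat -> M) : (forall l : 'I_k, a l = tnth t l) ->
  (fun i => if (i < k)%N then a i else lookup q w (i - k)%N) \o s
    = lookup r (push t w).
  move=> at_; apply/funext => i; rewrite /= /s /lookup /q.
  have nlt : (k + i < k)%N = false by rewrite -{2}[k]addn0 ltn_add2l.
  by case Er: (r i) => [[[|j] l]|m] /=; rewrite ?ltn_ord ?nlt ?addKn ?Er.
rewrite sat_iter_All; split=> [Pw a|sata t].
  rewrite sat_rename (step [tuple a l | l < k]); first exact/phiP.
  by move=> l; rewrite tnth_mktuple.
apply/phiP; rewrite -(step t (fun i => nth m0 t i)) -?sat_rename; first exact: sata.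
by move=> l; rewrite -tnth_nth.
Qed.

Lemma defin_not P : defin P -> defin (fun w => ~ P w).
Proof. by move=> dP; apply: defin_imp dP defin_False. Qed.

Lemma defin_and P Q : defin P -> defin Q -> defin (fun w => P w /\ Q w).
Proof.
move=> dP dQ; apply: defin_ext (defin_not (defin_imp dP (defin_not dQ))) => w.
split=> [[Pw Qw] /(_ Pw)//|nPQ].
by apply: contrapT => nP; apply: nPQ => Pw Qw; apply: nP.
Qed.

Lemma defin_ex P : defin P -> defin (fun w => exists t, P (push t w)).
Proof.
move=> dP; apply: defin_ext (defin_not (defin_all (defin_not dP))) => w.
by split=> [[t Pt] /(_ t)//|/existsNP[t /contrapT Pt]]; exists t.
Qed.

Lemma definable_defin n (D : set (n.-tuple M)) (s : 'I_n -> nat * 'I_k) :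
  definable D -> defin (fun w => D [tuple tnth (w (s i).1) (s i).2 | i < n]).
Proof.
move=> [phi [c ->]]; exists phi.
pose r i := if insub i is Some j then inl (s j) else inr (c (i - n)%N).
exists r => w /=; set v := (fun i => _); suff -> : v = lookup r w by [].
apply/funext => i; rewrite /v /lookup /r; case: insubP => [j ltin <-|].
  exact: nth_mktuple.
by rewrite -leqNgt => ni; rewrite nth_default // size_map size_enum_ord.
Qed.

Lemma defin_definable n P (s : nat -> 'I_k -> 'I_n) : defin P ->
  definable [set a : n.-tuple M | P (fun j => [tuple tnth a (s j l) | l < k])].
Proof.
move=> [phi [r phiP]].
(* A parameter moves to [n + i], beyond the tuple, where [nth] returns its default [c i]. *)
pose q i := match r i with inl (j, l) => val (s j l) | inr _ => (n + i)%N end.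
pose c i := match r i with inl _ => m0 | inr m => m end.
exists (rename q phi), c; apply/seteqP.
suff step (a : n.-tuple M) :
    lookup r (fun j => [tuple tnth a (s j l) | l < k])
      = (fun i => nth (c (i - n)%N) a i) \o q.
  by split=> a /=; rewrite phiP sat_rename step.
apply/funext => i; rewrite /lookup /= /q.
case Er : (r i) => [[j l]|m] /=; first by rewrite tnth_mktuple; apply: tnth_nth.
by rewrite nth_default ?size_tuple ?leq_addr // addKn /c Er.
Qed.

Definition triple w : (k + (k + k)).-tuple M := [tuple of w 0 ++ (w 1 ++ w 2)].

Lemma defin_set (D : set T) : definable D <-> defin (fun w => D (w 0)).
Proof.
split=> [/(definable_defin (fun l => (0, l)))|/(defin_definable (fun _ l => l))].
  by apply: defin_ext => w; set u := [tuple _ | _ < _];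
     suff -> : u = w 0 by []; apply: eq_from_tnth => l; rewrite tnth_mktuple.
rewrite (_ : [set _ | _] = D) //; apply/funext => a /=; congr D.
by apply: eq_from_tnth => l; rewrite tnth_mktuple.
Qed.

Lemma defin_triple (D : set ((k + (k + k)).-tuple M)) :
  definable D <-> defin (fun w => D (triple w)).
Proof.
split.
  pose s (i : 'I_(k + (k + k))) : nat * 'I_k := match fintype.split i with
    | inl l => (0, l)
    | inr j => match fintype.split j with inl l => (1, l) | inr l => (2, l) end end.
  move=> /(definable_defin s); apply: defin_ext => w.
  suff -> : triple w = [tuple tnth (w (s i).1) (s i).2 | i < k + (k + k)] by [].
  apply: eq_from_tnth => i; rewrite tnth_mktuple /s.
  case: (split_ordP i) => [l ->|j ->]; first by rewrite tnth_lshift.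
  by rewrite tnth_rshift; case: (split_ordP j) => l ->; rewrite ?tnth_lshift ?tnth_rshift.
pose s j (l : 'I_k) : 'I_(k + (k + k)) := match j with
  | 0 => lshift _ l | 1 => rshift k (lshift k l) | _ => rshift k (rshift k l) end.
move=> /(defin_definable s); rewrite (_ : [set _ | _] = D) //.
apply/funext => a /=; congr D; apply: eq_from_tnth => i.
case: (split_ordP i) => [l ->|j ->]; first by rewrite tnth_lshift tnth_mktuple.
by rewrite tnth_rshift; case: (split_ordP j) => l ->;
  rewrite ?tnth_lshift ?tnth_rshift tnth_mktuple.
Qed.

End TupleEnvironments.

(** * Definability of the stabilizer and of its stages *)

Section DefinableSubsets.
Variables (L : language) (M : structure L) (R : rngType) (k : nat).
Variables (e : R -> k.-tuple M) (X : set R).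
Hypothesis X_def : definable_via e X.
Hypothesis X0 : X 0.
Variable m0 : M.
Local Notation T := (k.-tuple M).
Local Notation G := (subring_gen X).
Local Notation def_set Z := (defin (fun w : nat -> T => (e @` Z) (w 0))).

Lemma e_inj x y : G x -> G y -> e x = e y -> x = y.
Proof. by move=> Gx Gy; case: X_def => inj _; apply: inj; apply: mem_set. Qed.

Lemma op_graphP op (Z : set R) (w : nat -> T) : op_graph e op Z (triple w) <->
  exists x y, [/\ Z x, Z y, w 0 = e x, w 1 = e y & w 2 = e (op x y)].
Proof.
have cat_inj n (a b : T) (c d : n.-tuple M) :
    val a ++ val c = val b ++ val d -> a = b /\ c = d.
  move=> eq_cat; split; apply: val_inj.
    by move: (congr1 (take k) eq_cat); rewrite !take_size_cat ?size_tuple.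
  by move: (congr1 (drop k) eq_cat); rewrite !drop_size_cat ?size_tuple.
split=> [[x Zx [y Zy /(congr1 val) eqw]]|[x [y [Zx Zy w0 w1 w2]]]].
  have [ex /(congr1 val) eqw'] := cat_inj _ _ _ [tuple of _] [tuple of _] eqw.
  by have [ey exy] := cat_inj _ _ _ _ _ eqw'; exists x, y.
by exists x => //; exists y => //; apply: val_inj; rewrite /= w0 w1 w2.
Qed.

Section Operation.
Variable op : R -> R -> R.
Hypothesis op_gen : forall x y, G x -> G y -> G (op x y).
Hypothesis op_def : forall n, definable (op_graph e op (stage X n)).

Let defin_graph n (s : nat -> nat) :
  defin (fun w : nat -> T => op_graph e op (stage X n) (triple (w \o s))).
Proof. exact: (defin_rename s ((defin_triple m0 _).1 (op_def n))). Qed.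

Lemma def_set_op n (A B : set R) : A `<=` stage X n -> B `<=` stage X n ->
  def_set A -> def_set B -> def_set [set op x y | x in A & y in B].
Proof.
move=> AX BX dA dB.
(* Under the two quantifiers, index 1 is the left operand, index 0 the right one, and index 2 the
   original entry 0, which is to be the result. *)
have := defin_ex m0 (defin_ex m0 (defin_and m0 (defin_rename (fun=> 1) dA)
  (defin_and m0 (defin_rename (fun=> 0) dB)
    (defin_graph n (fun i => nth 0 [:: 1; 0; 2] i)))))%N.
apply: defin_ext => w; split.
  move=> [_ [x Ax [y By <-]] ew]; exists (e x), (e y).
  split; first by exists x.
  split; first by exists y.
  by apply/op_graphP; exists x, y; split=> //; [apply: AX|apply: BX].
move=> [_ [_ /= [[x Ax <-] [[y By <-] /op_graphP[x' [y' [X'x X'y /= ex ey exy]]]]]]].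
have sG := @stage_sub_gen _ X n.
have eqx : x = x' by apply: e_inj => //; apply: sG => //; apply: AX.
have eqy : y = y' by apply: e_inj => //; apply: sG => //; apply: BX.
by exists (op x y); [exists x => //; exists y|rewrite exy eqx eqy].
Qed.

Lemma def_set_stabilizer n (K : set R) : K `<=` stage X n -> def_set K ->
  def_set [set y | K y /\ forall x, K x -> K (op y x)].
Proof.
move=> KX dK.
(* Innermost, index 2 is [y], index 1 the universally quantified [x], and index 0 their product,
   required to lie in [K]. *)
have := defin_and m0 dK (defin_all m0 (defin_imp dK (defin_ex m0
  (defin_and m0 dK (defin_graph n (fun i => nth 0 [:: 2; 1; 0] i))))))%N.
have sG := @stage_sub_gen _ X n.
apply: defin_ext => w; split.
  move=> [y [Ky yK] ew]; split; first by exists y.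
  move=> _ /= [x Kx <-]; exists (e (op y x)); split; first by exists (op y x) => //; apply: yK.
  by apply/op_graphP; exists y, x; split=> //; apply: KX.
move=> [[y Ky ew] yK]; exists y => //; split=> // x Kx.
have [|_ /= [[z Kz <-] /op_graphP[y' [x' [X'y X'x /= ey ex exy]]]]] := yK (e x).
  by exists x.
have KG := subset_trans KX sG.
have eqy : y = y' by apply: e_inj; [apply: KG|apply: sG|rewrite ew].
have eqx : x = x' by apply: e_inj; [apply: KG|apply: sG|].
(* The product may leave the stage [n], but it stays in the generated subring, where [e] is
   injective. *)
suff -> : op y x = z by [].
apply: e_inj; [|exact: KG|by rewrite exy eqx eqy].
by apply: op_gen; apply: KG.
Qed.

Lemma definable_op_graph n (Z : set R) : Z `<=` stage X n -> def_set Z ->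
  definable (op_graph e op Z).
Proof.
move=> ZX dZ; apply/(defin_triple m0).
have := defin_and m0 (defin_rename (fun=> 0) dZ)
  (defin_and m0 (defin_rename (fun=> 1) dZ) (defin_graph n id))%N.
have sG := @stage_sub_gen _ X n.
apply: defin_ext => w; split.
  move=> /op_graphP[x [y [Zx Zy w0 w1 w2]]]; split; first by exists x.
  split; first by exists y.
  by apply/op_graphP; exists x, y; split=> //; apply: ZX.
move=> [[x Zx ex] [[y Zy ey] /op_graphP[x' [y' [X'x X'y /= ex' ey' exy]]]]].
have ZG := subset_trans ZX sG.
have eqx : x = x' by apply: e_inj; [apply: ZG|apply: sG|rewrite ex].
have eqy : y = y' by apply: e_inj; [apply: ZG|apply: sG|rewrite ey].
by apply/op_graphP; exists x, y; split=> //; rewrite exy eqx eqy.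
Qed.

End Operation.

Let add_def n : definable (op_graph e +%R (stage X n)).
Proof. by case: X_def => _ /(_ n)[]. Qed.

Let mul_def n : definable (op_graph e (@rng_mul R) (stage X n)).
Proof. by case: X_def => _ /(_ n)[]. Qed.

Let mul_gen x y : G x -> G y -> G (rng_mul x y).
Proof. by case: (is_subring_gen X) => _ _; apply. Qed.

(** The stage [i] of [Y] lies in the stage [i + m] of [X], so the stages of [Y] and the operations
    on them are obtained from the definable graphs on the stages of [X]. *)
Lemma definable_via_sub m (Y : set R) : Y `<=` stage X m -> def_set Y ->
  definable_via e Y.
Proof.
move=> YX dY.
have YG : subring_gen Y `<=` G.
  apply: subring_gen_min; first exact: is_subring_gen.
  by apply: subset_trans YX _; apply: stage_sub_gen.
split=> [x y /set_mem /YG Gx /set_mem /YG Gy|n]; first exact: e_inj.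
have stY i : stage Y i `<=` stage X (i + m) by rewrite -stage_add; apply: stageS.
have dst i : def_set (stage Y i).
  elim: i => //= i IHi; apply: (def_set_op add_def (n := (i + m).+1)) => //.
  - exact: sumset_sub_stage.
  - exact: prodset_sub_stage.
  - exact: (def_set_op add_def (stY i)).
  - exact: (def_set_op mul_def (stY i)).
split; first exact/defin_set.
  exact: (definable_op_graph add_def (stY n)).
exact: (definable_op_graph mul_def (stY n)).
Qed.

Lemma def_set_stage n : def_set (stage X n).
Proof. by apply/(defin_set m0); case: X_def => _ /(_ n)[]. Qed.

Lemma def_set_big_set : approximate_subring X -> def_set (big_set X).
Proof.
move=> X_approx.
have dXX : def_set (sumset X X).
  by apply: (def_set_op add_def (n := 0)) => //; apply: (def_set_stage 0).
have d4X : def_set (nsumset 4 X).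
  rewrite nsumset4; have XX1 := sumset_sub_stage1 X_approx.
  exact: (def_set_op add_def XX1 XX1).
have X2 : X `<=` stage X 2 := stage_leq X0 (leq0n 2).
have X42 := nsumset4_sub_stage X_approx.
have dX4X : def_set (prodset X (nsumset 4 X)).
  by apply: (def_set_op mul_def X2 X42) => //; apply: (def_set_stage 0).
have X43 := subset_trans X42 (stage_leq X0 (leqnSn 2)).
exact: (def_set_op add_def X43 (prodset_sub_stage3 X_approx)).
Qed.

Lemma definable_via_big_stabilizer :
  approximate_subring X -> definable_via e (big_stabilizer X).
Proof.
move=> X_approx; have K4 := big_set_sub_stage X_approx.
apply: (definable_via_sub (m := 4)).
  by apply: subset_trans K4 => y [].
exact: (def_set_stabilizer mul_gen mul_def K4 (def_set_big_set X_approx)).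
Qed.

End DefinableSubsets.

Theorem corollary1p8 (L : language) (M : structure L) (R : rngType) (k : nat)
    (e : R -> k.-tuple M) (X : set R)
    (X_approx : approximate_subring X) (X_def : definable_via e X) :
  exists Y : set R,
    approximate_subring Y /\
    Y `<=` subring_gen X /\
    definable_via e Y /\
    commensurable X Y /\
    prodset Y Y `<=` Y /\
    Y `<=` sumset (nsumset 4 X) (prodset X (nsumset 4 X)).
Proof.
(* The parameters of any defining formula show that [M] is nonempty; [m0] is a default element. *)
have [_ /(_ 0%N)[[phi [c _]] _ _]] := X_def; have m0 : M := c 0%N.
exists (big_stabilizer X); split; first exact: big_stabilizer_approx.
have YK : big_stabilizer X `<=` big_set X by move=> y [].
split; first by apply: subset_trans YK _; apply: big_set_sub_gen.
split; first exact: (definable_via_big_stabilizer X_def (approx0 X_approx) m0).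
split; first exact: big_stabilizer_commensurable.
by split; first exact: big_stabilizer_mul.
Qed.
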